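(* Let $L$ be a lattice. Then the following are equivalent: (i) $L$ belongs to $\mathbf{SUB}_2$. (ii) $L$ satisfies the identities (L$_2$), (U), and (B). (iii) There are a tree-like poset $\Gamma$ of length at most $2$ and a lattice embedding $\varphi\colon L\hookrightarrow\mathbf{Co}(\Gamma)$ that preserves the existing bounds. Furthermore, the following additional properties hold: if $L$ is finite, then $\Gamma$ is finite; if $L$ is finite and subdirectly irreducible, then $\varphi$ is atom-preserving.
   Context: For a poset $(P,\trianglelefteq)$, a subset $X\subseteq P$ is order-convex if $x\trianglelefteq z\trianglelefteq y$ and $\{x,y\}\subseteq X$ imply $z\in X$. $\mathbf{Co}(P)$ is the lattice of all order-convex subsets of $P$ under inclusion. The length of $P$ is the supremum of $|C|-1$ over finite subchains $C$ of $P$. $\mathbf{SUB}_2$ is the class of all lattices that can be embedded (as lattices) into $\mathbf{Co}(P)$ for some poset $P$ of length at most $2$. A poset $P$ with predecessor (covering) relation $\prec$ is tree-like if it has no infinite bounded chain and for any points $a,b$ of $P$ there exists at most one finite sequence $\langle x_i\mid 0\le i\le n\rangle$ with distinct entries such that $x_0=a$, $x_n=b$, and either $x_i\prec x_{i+1}$ or $x_{i+1}\prec x_i$ for all $i\in\{0,\dots,n-1\}$. ''Preserves the existing bounds'': if $L$ has a least (resp., greatest) element, $\varphi$ maps it to the least (resp., greatest) element of $\mathbf{Co}(\Gamma)$. ''Atom-preserving'': $\varphi$ maps atoms of $L$ to atoms of $\mathbf{Co}(\Gamma)$. Identity (L$_2$): $$a\wedge\Bigl(\bigl(b\wedge(c\vee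 c')\bigr)\vee b'\Bigr)=\bigl(a\wedge b\wedge(c\vee c')\bigr)\vee\Bigl(a\wedge\bigl((b\wedge c)\vee b'\bigr)\Bigr)\vee\Bigl(a\wedge\bigl((b\wedge c')\vee b'\bigr)\Bigr).$$ Identity (U): $$x\wedge(x_0\vee x_1)\wedge(x_1\vee x_2)\wedge(x_0\vee x_2)=(x\wedge x_0\wedge(x_1\vee x_2))\vee(x\wedge x_1\wedge(x_0\vee x_2))\vee(x\wedge x_2\wedge(x_0\vee x_1)).$$ Identity (B): $$x\wedge(a_0\vee a_1)\wedge(b_0\vee b_1)=\bigvee_{i<2}\Bigl(\bigl(x\wedge a_i\wedge(b_0\vee b_1)\bigr)\vee\bigl(x\wedge b_i\wedge(a_0\vee a_1)\bigr)\Bigr)\vee\bigvee_{i<2}\bigl(x\wedge(a_0\vee a_1)\wedge(b_0\vee b_1)\wedge(a_0\vee b_i)\wedge(a_1\vee b_{1-i})\bigr).$$ *)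

(* Defs.v *)
From HB Require Import structures.
From mathcomp Require Export all_boot all_order.
From mathcomp Require Export finmap.
From mathcomp Require Export boolp classical_sets functions cardinality.

Set Implicit Arguments.
Unset Strict Implicit.
Unset Printing Implicit Defensive.

Import Order.TTheory.

Local Open Scope classical_set_scope.
Local Open Scope order_scope.

Section PosetNotions.
Context {d : Order.disp_t} {P : porderType d}.
Implicit Types (x y z a b : P) (C X : set P).

Definition least x : Prop := lbound [set: P] x.

Definition greatest x : Prop := ubound [set: P] x.

Definition covered x y : Prop := x < y /\ forall z, ~ (x < z /\ z < y).

Definition atom a : Prop := exists2 z, least z & covered z a.

Definition is_chain C : Prop := total_on C (fun x y => x <= y).

Definition order_convex X : Prop :=
  forall x y z, X x -> X y -> x <= z -> z <= y -> X z.

Definition hasse_adjacent : rel P :=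
  fun x y => `[< covered x y \/ covered y x >].

(* The sequence x_0, ..., x_n from a to b is encoded as its head a = x_0 and
   the list s of x_1, ..., x_n. *)
Definition hasse_path a b (s : seq P) : Prop :=
  [/\ path hasse_adjacent a s, last a s = b & uniq (a :: s)].

End PosetNotions.

(* The length is a supremum, so it is at most n exactly when n bounds the
   number of elements minus one of every finite chain. *)
Definition length_at_most (n : nat) d (P : porderType d) : Prop :=
  forall C : {fset P}, is_chain [set` C] -> (#|` C| - 1 <= n)%N.

Definition tree_like d (P : porderType d) : Prop :=
  (forall C : set P,
     is_chain C -> has_lbound C -> has_ubound C -> finite_set C) /\
  (forall (a b : P) (s t : seq P),
     hasse_path a b s -> hasse_path a b t -> s = t).

Section OrderConvexSubsets.
Context {d : Order.disp_t} {P : porderType d}.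
Implicit Types X Y : set P.

Definition convex_hull X : set P :=
  [set z | exists x y, [/\ X x, X y & x <= z <= y]].

Lemma sub_convex_hull X : X `<=` convex_hull X.
Proof. by move=> x Xx; exists x, x; rewrite !lexx. Qed.

Lemma order_convex_hull X : order_convex (convex_hull X).
Proof.
move=> x y z [x1 [_ [X1 _ /andP[x1x _]]]] [_ [y2 [_ X2 /andP[_ yy2]]]] xz zy.
by exists x1, y2; split=> //; rewrite (le_trans x1x xz) (le_trans zy yy2).
Qed.

Lemma convex_hull_min X Y : order_convex Y -> X `<=` Y -> convex_hull X `<=` Y.
Proof.
by move=> cY XY z [x [y [/XY Yx /XY Yy /andP[xz zy]]]]; apply: cY Yx Yy xz zy.
Qed.

Lemma order_convexI X Y :
  order_convex X -> order_convex Y -> order_convex (X `&` Y).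
Proof.
move=> cX cY x y z [Xx Yx] [Xy Yy] xz zy.
by split; [apply: cX xz zy | apply: cY xz zy].
Qed.

End OrderConvexSubsets.

Record Co d (P : porderType d) : Type := MkCo {
  co_set :> set P;
  co_convex : `[< order_convex co_set >] }.

Fact co_display : Order.disp_t. Proof. exact: (Order.Disp tt tt). Qed.

Section CoLattice.
Context {d : Order.disp_t} {P : porderType d}.

HB.instance Definition _ := [isSub for @co_set d P].
HB.instance Definition _ := [Choice of Co P by <:].

Implicit Types A B C : Co P.

Lemma coP A : order_convex A.
Proof. exact/asboolP/co_convex. Qed.

Definition co_le A B : bool := `[< co_set A `<=` co_set B >].

Lemma co_le_refl : reflexive co_le.
Proof. by move=> A; apply/asboolP. Qed.

Lemma co_le_anti : antisymmetric co_le.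
Proof.
by move=> A B /andP[/asboolP AB /asboolP BA]; apply/val_inj/seteqP; split.
Qed.

Lemma co_le_trans : transitive co_le.
Proof.
by move=> B A C /asboolP AB /asboolP BC; apply/asboolP => x /AB /BC.
Qed.

HB.instance Definition _ :=
  Order.Le_isPOrder.Build co_display (Co P) co_le_refl co_le_anti co_le_trans.

Lemma le_coP A B : reflect (co_set A `<=` co_set B) (A <= B).
Proof. exact: asboolP. Qed.

Definition co_meet A B : Co P :=
  MkCo (asboolT (order_convexI (@coP A) (@coP B))).

Definition co_join A B : Co P :=
  MkCo (asboolT (@order_convex_hull d P (co_set A `|` co_set B))).

Lemma co_meetP C A B : (C <= co_meet A B) = (C <= A) && (C <= B).
Proof.
apply/le_coP/andP => /= [CAB|[/le_coP CA /le_coP CB]].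
  by split; apply/le_coP => x /CAB [].
by move=> x Cx; split; [apply: CA | apply: CB].
Qed.

Lemma co_joinP A B C : (co_join A B <= C) = (A <= C) && (B <= C).
Proof.
apply/le_coP/andP => /= [ABC|[/le_coP AC /le_coP BC]].
  by split; apply/le_coP => x ?; apply/ABC/sub_convex_hull; [left | right].
by apply: convex_hull_min (@coP C) _ => x [/AC|/BC].
Qed.

HB.instance Definition _ :=
  Order.POrder_MeetJoin_isLattice.Build co_display (Co P) co_meetP co_joinP.

End CoLattice.

Section LatticeNotions.
Context {d : Order.disp_t} {L : latticeType d}.

Definition lattice_embedding d' (M : latticeType d') (f : L -> M) : Prop :=
  [/\ injective f, Order.meet_morphism f & Order.join_morphism f].

Definition preserves_existing_bounds d' (M : latticeType d') (f : L -> M)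
    : Prop :=
  (forall x, least x -> least (f x)) /\
  (forall x, greatest x -> greatest (f x)).

Definition atom_preserving d' (M : latticeType d') (f : L -> M) : Prop :=
  forall x, atom x -> atom (f x).

Record congruence (r : L -> L -> Prop) : Prop := {
  congr_refl : forall x, r x x;
  congr_sym : forall x y, r x y -> r y x;
  congr_trans : forall x y z, r x y -> r y z -> r x z;
  congr_meet : forall x y x' y',
    r x y -> r x' y' -> r (x `&` x') (y `&` y');
  congr_join : forall x y x' y',
    r x y -> r x' y' -> r (x `|` x') (y `|` y') }.

Definition nonzero (r : L -> L -> Prop) : Prop := exists x y, r x y /\ x <> y.

End LatticeNotions.

(* Existence of a monolith, i.e., of a least nonzero congruence. *)
Definition subdirectly_irreducible d (L : latticeType d) : Prop :=
  exists m : L -> L -> Prop, [/\ congruence m, nonzero m &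
    forall r : L -> L -> Prop, congruence r -> nonzero r ->
      forall x y, m x y -> r x y].

Definition SUB (n : nat) d (L : latticeType d) : Prop :=
  exists (d' : Order.disp_t) (P : porderType d') (f : L -> Co P),
    length_at_most n P /\ lattice_embedding f.

Definition identity_L2 d (L : latticeType d) : Prop :=
  forall a b b' c c' : L,
    a `&` ((b `&` (c `|` c')) `|` b') =
    (a `&` b `&` (c `|` c'))
      `|` (a `&` ((b `&` c) `|` b'))
      `|` (a `&` ((b `&` c') `|` b')).

Definition identity_U d (L : latticeType d) : Prop :=
  forall x x0 x1 x2 : L,
    x `&` (x0 `|` x1) `&` (x1 `|` x2) `&` (x0 `|` x2) =
    (x `&` x0 `&` (x1 `|` x2))
      `|` (x `&` x1 `&` (x0 `|` x2))
      `|` (x `&` x2 `&` (x0 `|` x1)).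

Definition identity_B d (L : latticeType d) : Prop :=
  forall x a0 a1 b0 b1 : L,
    x `&` (a0 `|` a1) `&` (b0 `|` b1) =
    (((x `&` a0 `&` (b0 `|` b1)) `|` (x `&` b0 `&` (a0 `|` a1)))
      `|` ((x `&` a1 `&` (b0 `|` b1)) `|` (x `&` b1 `&` (a0 `|` a1))))
    `|` ((x `&` (a0 `|` a1) `&` (b0 `|` b1) `&` (a0 `|` b0) `&` (a1 `|` b1))
      `|` (x `&` (a0 `|` a1) `&` (b0 `|` b1) `&` (a0 `|` b1) `&` (a1 `|` b0))).

(* Main.v *)
From HB Require Import structures.
Require Import Defs.

Set Implicit Arguments.
Unset Strict Implicit.
Unset Printing Implicit Defensive.

Import Order.TTheory.

Local Open Scope classical_set_scope.
Local Open Scope order_scope.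

(** The identities hold in Co(P) pointwise: a point z outside two convex sets
    lies in their join exactly when one of them has an element below z and the
    other one an element above z. Given this, (U) and (B) are propositional
    facts about which sets reach below z and which reach above z
    ([Co_identity_U], [Co_identity_B]), and a failure of (L2) produces a chain
    of four points ([Co_identity_L2]). Identities pass to sublattices.

    Conversely, let L satisfy the identities. The points of the poset come from
    filters of L. Order filters by reverse inclusion, so that p lies below the
    element u when u belongs to p; L embeds into the lattice so obtained, and
    the filters p maximal among those that miss some element v are completely
    join-irreducible there and separate the elements of L
    ([exists_irreducible_filter]). Irreducibility turns an identity with
    left-hand side in p into the statement that one of the summands on the
    right is in p. Read in this way at a fixed p, with u ~ w meaning that u and
    w are not in p while their join is, (U) says that the graph ~ has no
    triangle and (B) that any two edges lie on a common square. Hence ~ is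
    complete bipartite up to isolated points. By (L2), each edge u ~ w extends
    to a prime filter x containing u all of whose elements join with w into p
    ([exists_prime_cofactor]). So there are two sets A and B of prime filters
    such that u and w join into p nontrivially exactly when one of them lies in
    a member of A and the other in a member of B ([exists_cofactor_sides]).

    The star of p has center p, the members of A below it and those of B above
    it. On the disjoint union of stars, send u to the set of the points whose
    filter contains u. Prime filters preserve joins, and at the center joins are
    computed by the two sides, so this is a lattice embedding into the convex
    subsets of a forest of stars ([embed_lattice_embedding]), which is tree-like
    and of length at most two.

    To preserve atoms, keep only the stars whose center, called a root, is not a
    leaf of another star; this loses no filter, because the center of a star
    with leaves is not prime and hence is never a leaf. For each root p of a
    finite L, the elements of L agreeing everywhere but at the center p form the
    classes of a nonzero congruence, and two such congruences for different
    roots meet in the identity. Hence a subdirectly irreducible L has a single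
    root; in one star a filter occurs only once, and an atom lies in a single
    filter of the star. *)

(** * The identities in lattices of convex sets *)

(** Whitman's decision procedure for inequalities in free lattices. *)
Ltac lattice_le :=
  solve [ exact: lexx
        | rewrite leUx; apply/andP; split; lattice_le
        | rewrite lexI; apply/andP; split; lattice_le
        | apply: leIxl; lattice_le | apply: leIxr; lattice_le
        | apply: lexUl; lattice_le | apply: lexUr; lattice_le ].

(** In each of the three identities, every summand of the right-hand side lies
    below the left-hand side in any lattice. *)
Section IdentitiesFromInequalities.
Context {d : Order.disp_t} {L : latticeType d}.

Lemma identity_L2_le :
  (forall a b b' c c' : L,
    a `&` ((b `&` (c `|` c')) `|` b') <=
    (a `&` b `&` (c `|` c'))
      `|` (a `&` ((b `&` c) `|` b'))
      `|` (a `&` ((b `&` c') `|` b'))) -> identity_L2 L.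
Proof.
by move=> le a b b' c c'; apply/le_anti; rewrite le /=; lattice_le.
Qed.

Lemma identity_U_le :
  (forall x x0 x1 x2 : L,
    x `&` (x0 `|` x1) `&` (x1 `|` x2) `&` (x0 `|` x2) <=
    (x `&` x0 `&` (x1 `|` x2))
      `|` (x `&` x1 `&` (x0 `|` x2))
      `|` (x `&` x2 `&` (x0 `|` x1))) -> identity_U L.
Proof.
by move=> le x x0 x1 x2; apply/le_anti; rewrite le /=; lattice_le.
Qed.

Lemma identity_B_le :
  (forall x a0 a1 b0 b1 : L,
    x `&` (a0 `|` a1) `&` (b0 `|` b1) <=
    (((x `&` a0 `&` (b0 `|` b1)) `|` (x `&` b0 `&` (a0 `|` a1)))
      `|` ((x `&` a1 `&` (b0 `|` b1)) `|` (x `&` b1 `&` (a0 `|` a1))))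
    `|` ((x `&` (a0 `|` a1) `&` (b0 `|` b1) `&` (a0 `|` b0) `&` (a1 `|` b1))
      `|` (x `&` (a0 `|` a1) `&` (b0 `|` b1) `&` (a0 `|` b1) `&` (a1 `|` b0))))
  -> identity_B L.
Proof.
by move=> le x a0 a1 b0 b1; apply/le_anti; rewrite le /=; lattice_le.
Qed.

End IdentitiesFromInequalities.

Section ConvexSubsetIdentities.
Context {d : Order.disp_t} {P : porderType d}.
Implicit Types (A B : Co P) (z : P).

Definition has_below (A : set P) z : Prop := exists2 x, A x & x <= z.

Definition has_above (A : set P) z : Prop := exists2 y, A y & z <= y.

(** Together with [co_joinE], this reduces membership in meets and joins to
    propositional combinations of [has_below] and [has_above]. *)
Lemma coE A z : co_set A z <-> has_below A z /\ has_above A z.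
Proof.
split=> [Az|[[x Ax xz] [y Ay zy]]]; last exact: coP Ax Ay xz zy.
by split; exists z.
Qed.

Lemma co_joinE A B z :
  co_set (A `|` B) z <->
  (has_below A z \/ has_below B z) /\ (has_above A z \/ has_above B z).
Proof.
split=> [[x [y [ABx ABy /andP[xz zy]]]]|[hx hy]].
  by split; [case: ABx|case: ABy] => ?; [left|right|left|right];
    first [by exists x | by exists y].
have [x ABx xz] : has_below (co_set A `|` co_set B)%classic z.
  by case: hx => -[x ? ?]; exists x => //; [left|right].
have [y ABy zy] : has_above (co_set A `|` co_set B)%classic z.
  by case: hy => -[y ? ?]; exists y => //; [left|right].
by exists x, y; rewrite xz zy.
Qed.

Lemma co_joinl A B z : co_set A z -> co_set (A `|` B) z.
Proof. by move: z; apply/le_coP; rewrite leUl. Qed.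

Lemma co_joinr A B z : co_set B z -> co_set (A `|` B) z.
Proof. by move: z; apply/le_coP; rewrite leUr. Qed.

(** If z is in no A_i, then each A_i fails to reach below z or fails to reach
    above z. Two of the three fail on the same side, so their join misses z. *)
Lemma Co_identity_U : identity_U (Co P).
Proof.
apply: identity_U_le => X A0 A1 A2; apply/le_coP => z [[[Xz J01] J12] J02].
suff : co_set A0 z \/ co_set A1 z \/ co_set A2 z.
  by case=> [?|[?|?]];
    [apply/co_joinl/co_joinl|apply/co_joinl/co_joinr|apply/co_joinr].
move: J01 J12 J02; rewrite !co_joinE !coE; tauto.
Qed.

(** If z is in none of the four sets, then exactly one A_i reaches below z and
    exactly one B_j does; pair each of these with the other set of the other
    kind, which reaches above z. *)
Lemma Co_identity_B : identity_B (Co P).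
Proof.
apply: identity_B_le => X A0 A1 B0 B1; apply/le_coP => z [[Xz JA] JB].
have [|] :=
  pselect ((co_set A0 z \/ co_set B0 z) \/ (co_set A1 z \/ co_set B1 z)).
  case=> -[?|?]; apply: co_joinl.
  - by apply/co_joinl/co_joinl.
  - by apply/co_joinl/co_joinr.
  - by apply/co_joinr/co_joinl.
  - by apply/co_joinr/co_joinr.
move=> nAB; apply: co_joinr.
suff : (co_set (A0 `|` B0) z /\ co_set (A1 `|` B1) z) \/
       (co_set (A0 `|` B1) z /\ co_set (A1 `|` B0) z).
  by case=> -[? ?]; [apply/co_joinl|apply/co_joinr].
move: JA JB nAB; rewrite !co_joinE !coE; tauto.
Qed.

Lemma length2_no_chain4 (x y z t : P) :
  length_at_most 2 P -> x < y -> y < z -> z < t -> False.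
Proof.
move=> len xy yz zt.
have xz := lt_trans xy yz; have yt := lt_trans yz zt.
have xt := lt_trans xz zt.
pose C := [fset u | u in [:: x; y; z; t]]%fset.
have Cchain : is_chain [set` C].
  move=> u w; rewrite /= !in_fset !inE.
  by case/or4P=> /eqP-> /or4P[] /eqP->;
    rewrite ?lexx ?(ltW xy) ?(ltW xz) ?(ltW xt) ?(ltW yz) ?(ltW yt) ?(ltW zt);
    first [by left | by right].
have := len C Cchain.
have /lt_sorted_uniq uC : sorted <%O [:: x; y; z; t] by rewrite /= xy yz zt.
by rewrite card_fseq undup_id.
Qed.

(** A point z in the join of B meet (C join C') with B', but in neither of them,
    lies strictly between some s in the former and some t in the latter. Were s
    in neither C nor C', it would lie strictly between elements of these, and
    one of the two together with s, z and t would form a chain of four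
    points. *)
Lemma Co_identity_L2 : length_at_most 2 P -> identity_L2 (Co P).
Proof.
move=> len; apply: identity_L2_le => A B B' C C'; apply/le_coP => z [Az zJ].
have [zBC|nzBC] := pselect (co_set (B `&` (C `|` C')) z).
  by do 2 apply: co_joinl; case: zBC.
have [?|nzB'] := pselect (co_set B' z).
  by apply: co_joinr; split=> //; apply: co_joinr.
have [s sBC sB'] : exists2 s, co_set (B `&` (C `|` C')) s &
    (has_below B' z /\ z <= s) \/ (s <= z /\ has_above B' z).
  move: zJ nzBC nzB'; rewrite co_joinE (coE (B `&` _)) (coE B').
  case=> -[[x ? ?]|?] [[y ? ?]|?] nBC nB'.
  - by case: nBC; split; [exists x|exists y].
  - by exists x; [|right].
  - by exists y; [|left].
  - by case: nB'.
have [Bs sCC'] := sBC.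
have join_z D : co_set D s -> co_set ((B `&` D) `|` B') z.
  move=> Ds; have BDs : co_set (B `&` D) s by split.
  by apply/co_joinE; case: sB' => -[? ?]; split; (by right) || left; exists s.
suff [Cs|C's] : co_set C s \/ co_set C' s.
- by apply/co_joinl/co_joinr; split=> //; apply: join_z.
- by apply/co_joinr; split=> //; apply: join_z.
apply: contrapT => /not_orP[nCs nC's].
have [[e CC'e es] [e' CC'e' se']] :
    has_below (co_set C `|` co_set C')%classic s /\
    has_above (co_set C `|` co_set C')%classic s.
  by move: sCC' => /co_joinE[hx hy]; split; [case: hx|case: hy] => -[w ? ?];
    exists w => //; (by left) || (by right).
have strict w : (co_set C `|` co_set C')%classic w -> s != w.
  by move=> CC'w; apply/eqP=> sw; case: CC'w; rewrite -sw.
have lt_es : e < s by rewrite lt_def es strict.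
have lt_se' : s < e' by rewrite lt_def se' eq_sym strict.
have zNs : z != s by apply/eqP=> zs; apply: nzBC; rewrite zs.
have zN t : co_set B' t -> z != t.
  by move=> B't; apply/eqP=> zt; apply: nzB'; rewrite zt.
case: sB' => [[[t B't tz] zs]|[sz [t B't zt]]].
  apply: (@length2_no_chain4 t z s e') => //.
  - by rewrite lt_def tz zN.
  - by rewrite lt_neqAle zNs zs.
apply: (@length2_no_chain4 e s z t) => //.
- by rewrite lt_def sz zNs.
- by rewrite lt_neqAle zt zN.
Qed.

End ConvexSubsetIdentities.

Section IdentityTransfer.
Context {d d' : Order.disp_t} {L : latticeType d} {M : latticeType d'}.
Variable f : L -> M.
Hypothesis embf : lattice_embedding f.

Lemma embedding_identity_L2 : identity_L2 M -> identity_L2 L.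
Proof.
case: embf => inj fI fU id a b b' c c'; apply: inj.
by rewrite !(fI, fU); apply: id.
Qed.

Lemma embedding_identity_U : identity_U M -> identity_U L.
Proof.
case: embf => inj fI fU id x x0 x1 x2; apply: inj.
by rewrite !(fI, fU); apply: id.
Qed.

Lemma embedding_identity_B : identity_B M -> identity_B L.
Proof.
case: embf => inj fI fU id x a0 a1 b0 b1; apply: inj.
by rewrite !(fI, fU); apply: id.
Qed.

End IdentityTransfer.

(** * Irreducible filters and their cofactors *)

Section Filters.
Context {d : Order.disp_t} {L : latticeType d}.
Implicit Types (a b c u v w : L) (p q x y S : set L).

Definition up_closed S : Prop := forall a b, S a -> a <= b -> S b.

Record lattice_filter x : Prop := {
  filter_nonempty : x !=set0;
  filter_up : up_closed x;
  filter_meet : forall a b, x a -> x b -> x (a `&` b) }.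

Definition prime_filter x : Prop :=
  lattice_filter x /\ forall a b, x (a `|` b) -> x a \/ x b.

(** When S is up-closed, the last clause says that no filter strictly containing
    x is included in S. *)
Definition maximal_filter_in S x : Prop :=
  [/\ lattice_filter x, x `<=` S &
      forall c, ~ x c -> exists2 s, x s & ~ S (s `&` c)].

Lemma exists_maximal_filter_in S u :
  up_closed S -> S u -> exists2 x, maximal_filter_in S x & x u.
Proof.
move=> upS Su.
(* Zorn's lemma includes the empty chain, hence the empty set among the
   candidates. *)
pose cand : set (set L) := [set x | [/\ up_closed x,
  forall a b, x a -> x b -> x (a `&` b), x `<=` S & x !=set0 -> x u]].
have chain_cand (F : set (set L)) :
    F `<=` cand -> total_on F subset -> cand (\bigcup_(x in F) x).
  move=> Fcand Ftot; split.
  - move=> a b [x Fx xa] ab; exists x => //.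
    by case: (Fcand _ Fx) => up _ _ _; exact: up ab.
  - move=> a b [x Fx xa] [y Fy yb].
    have [xy|yx] := Ftot _ _ Fx Fy.
      by exists y => //; case: (Fcand _ Fy) => _ + _ _; apply=> //; apply: xy.
    by exists x => //; case: (Fcand _ Fx) => _ + _ _; apply=> //; apply: yx.
  - by move=> a [x Fx xa]; case: (Fcand _ Fx) => _ _ + _; apply.
  - move=> [a [x Fx xa]]; exists x => //.
    by case: (Fcand _ Fx) => _ _ _; apply; exists a.
have [x [[upx meetx xS xu0] xmax]] := Zorn_bigcup chain_cand.
have xu : x u.
  apply: contrapT => nxu; apply: (xmax [set t | u <= t]); last first.
    split=> [a b /= ua /(le_trans ua)//|a b ua ub|a|_] /=.
    - by rewrite lexI ua ub.
    - exact: upS.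
    - exact: lexx.
  split=> [|ux]; last by apply/nxu/ux => /=.
  by move=> a xa; case: nxu; apply: xu0; exists a.
exists x => //; split=> //; first by split=> //; exists u.
move=> c nxc; apply: contrapT => nS.
(* The filter generated by x and c is a larger candidate. *)
apply: (xmax [set t | exists2 s, x s & s `&` c <= t]).
  split=> [a xa|sub]; first by exists a => //; rewrite leIl.
  by case: nxc; apply: sub; exists u => //; rewrite leIr.
split.
- by move=> a b [s xs sa] ab; exists s => //; apply: le_trans ab.
- move=> a b [s xs sa] [t xt tb]; exists (s `&` t); first exact: meetx.
  by rewrite lexI (le_trans _ sa) ?(le_trans _ tb) // leI2 ?leIl ?leIr.
- move=> a [s xs /upS]; apply; apply: contrapT => nSsc.
  by apply: nS; exists s.
- by move=> _; exists u => //; rewrite leIl.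
Qed.

Definition avoiding v x : Prop := maximal_filter_in [set w | ~ w <= v] x.

(** These are the completely join-irreducible elements of the lattice of filters
    under reverse inclusion: the unique lower cover of x is generated by x and
    v. *)
Definition filter_irreducible x : Prop := exists v, avoiding v x.

Lemma exists_irreducible_filter u w :
  ~ u <= w -> exists p, [/\ filter_irreducible p, p u & ~ p w].
Proof.
move=> uw.
have [||p pmax pu] := @exists_maximal_filter_in [set t | ~ t <= w] u => //.
  by move=> a b naw ab /(le_trans ab).
by exists p; split=> //; [exists w|case: pmax => _ sub _ /sub; apply].
Qed.

Lemma irreducible_filter p : filter_irreducible p -> lattice_filter p.
Proof. by case=> v []. Qed.

(** This is how irreducibility is used: if an identity rewrites an element of p
    containing the factor c as a join of elements below the c `&` g, then that
    join lies below v and cannot be in p. *)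
Lemma irreducible_escape p (gs : seq L) :
  filter_irreducible p -> {in gs, forall g, ~ p g} ->
  exists v c, [/\ ~ p v, p c & {in gs, forall g, c `&` g <= v}].
Proof.
move=> [v [[[e pe] up pI] pv pmax]] ngs; exists v.
have npv : ~ p v by move=> /pv; apply.
suff [c pc cgs] : exists2 c, p c & {in gs, forall g, c `&` g <= v} by exists c.
elim: gs ngs => [|g gs IH] ngs; first by exists e.
have [|c pc cgs] := IH; first by move=> h hgs; apply: ngs; rewrite inE hgs orbT.
have [|s ps /contrapT sg] := pmax g; first by apply: ngs; rewrite mem_head.
exists (c `&` s); first exact: pI.
move=> h; rewrite inE => /predU1P[->|/cgs ch].
  by rewrite (le_trans _ sg) // leI2 // leIr.
by rewrite (le_trans _ ch) // leI2 // leIl.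
Qed.

(** The graph of nontrivial joins into p has no triangle. *)
Lemma irreducible_U p (a b c : L) : identity_U L -> filter_irreducible p ->
  p (a `|` b) -> p (b `|` c) -> p (a `|` c) -> [\/ p a, p b | p c].
Proof.
move=> idU irrp pab pbc pac; apply: contrapT => nabc.
have [|v [e [npv pe eg]]] := @irreducible_escape p [:: a; b; c] irrp.
  by move=> g; rewrite !inE => /or3P[]/eqP-> pg; apply: nabc;
    [constructor 1|constructor 2|constructor 3].
have [_ up pI] := irreducible_filter irrp; apply: npv.
apply: (up (e `&` (a `|` b) `&` (b `|` c) `&` (a `|` c))).
  by do !apply: (pI _ _).
have le_v g t : g \in [:: a; b; c] -> e `&` g `&` t <= v.
  by move=> /eg; apply: leIxl.
by rewrite idU !leUx !le_v ?inE ?eqxx ?orbT.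
Qed.

(** Two edges of the graph of nontrivial joins into p lie on a common square. *)
Lemma irreducible_B p (a0 a1 b0 b1 : L) :
  identity_B L -> filter_irreducible p ->
  ~ p a0 -> ~ p a1 -> ~ p b0 -> ~ p b1 -> p (a0 `|` a1) -> p (b0 `|` b1) ->
  (p (a0 `|` b0) /\ p (a1 `|` b1)) \/ (p (a0 `|` b1) /\ p (a1 `|` b0)).
Proof.
move=> idB irrp na0 na1 nb0 nb1 pa pb.
have [_ up pI] := irreducible_filter irrp.
pose g0 := (a0 `|` b0) `&` (a1 `|` b1); pose g1 := (a0 `|` b1) `&` (a1 `|` b0).
suff pg : p g0 \/ p g1.
  by case: pg => pg; [left|right]; split; apply: (up _ _ pg);
    rewrite ?leIl ?leIr.
apply: contrapT => /not_orP[ng0 ng1].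
have [|v [e [npv pe eg]]] :=
    @irreducible_escape p [:: a0; a1; b0; b1; g0; g1] irrp.
  by move=> g; rewrite !inE => /or4P[/eqP->|/eqP->|/eqP->|/or3P[]/eqP->].
apply: npv; apply: (up (e `&` (a0 `|` a1) `&` (b0 `|` b1))).
  by do !apply: (pI _ _).
have le_v g t : g \in [:: a0; a1; b0; b1; g0; g1] -> t <= e `&` g -> t <= v.
  by move=> /eg egv /le_trans; apply.
rewrite idB !leUx; do ![apply/andP; split];
  [apply: (le_v a0)|apply: (le_v b0)|apply: (le_v a1)|apply: (le_v b1)
  |apply: (le_v g0)|apply: (le_v g1)];
  by [rewrite !inE eqxx ?orbT | rewrite /g0 /g1; lattice_le].
Qed.

Lemma irreducible_L2 p (b b' c c' : L) :
  identity_L2 L -> filter_irreducible p ->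
  p ((b `&` (c `|` c')) `|` b') ->
  [\/ p (b `&` (c `|` c')), p ((b `&` c) `|` b') | p ((b `&` c') `|` b')].
Proof.
move=> idL irrp pb; apply: contrapT => nor.
have [|v [e [npv pe eg]]] := @irreducible_escape p
    [:: b `&` (c `|` c'); (b `&` c) `|` b'; (b `&` c') `|` b'] irrp.
  by move=> g; rewrite !inE => /or3P[]/eqP-> pg; apply: nor;
    [constructor 1|constructor 2|constructor 3].
have [_ up pI] := irreducible_filter irrp; apply: npv.
apply: (up _ _ (pI _ _ pe pb)).
by rewrite idL -meetA !leUx !eg ?inE ?eqxx ?orbT.
Qed.

(** A maximal filter x containing u among those whose elements all join with w
    into p is prime: if c `|` c' is in x but neither c nor c' is, then some
    b <= u in x is such that neither b `&` c nor b `&` c' joins with w into p,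
    and (L2) puts b `&` (c `|` c') in p, hence also u, a contradiction. *)
Lemma exists_prime_cofactor p u w : identity_L2 L -> filter_irreducible p ->
  ~ p u -> p (u `|` w) ->
  exists x, [/\ prime_filter x, x u & forall s, x s -> p (s `|` w)].
Proof.
move=> idL irrp npu puw; have [_ up pI] := irreducible_filter irrp.
have [||x [filx xS xmax] xu] :=
  @exists_maximal_filter_in [set s | p (s `|` w)] u => //.
  by move=> a b pa ab; apply: (up _ _ pa); apply: leU2.
exists x; split=> //; split=> // c c' xcc'.
apply: contrapT => /not_orP[/xmax[s xs nsc] /xmax[s' xs' nsc']].
have [_ upx xI] := filx.
pose b := u `&` s `&` s'.
have xb : x b by do !apply: (xI _ _).
have bu : b <= u by rewrite /b -meetA leIl.
have bs : b <= s by rewrite /b leIxl // leIr.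
have bs' : b <= s' by rewrite /b leIr.
have := irreducible_L2 idL irrp (xS _ (xI _ _ xb xcc')).
case=> [pb|pb|pb].
- by apply: npu; apply: (up _ _ pb); rewrite leIxl.
- by apply: nsc; apply: (up _ _ pb); apply: leU2 => //; apply: leI2.
- by apply: nsc'; apply: (up _ _ pb); apply: leU2 => //; apply: leI2.
Qed.

(** The two classes of the bipartite graph of nontrivial joins into p, as
    families of prime filters; both are empty when p is prime. *)
Record cofactor_sides p (A B : set (set L)) : Prop := {
  side_prime : forall x, (A `|` B) x -> prime_filter x;
  side_proper : forall x, (A `|` B) x -> exists a, ~ x a;
  side_not_below : forall x, (A `|` B) x -> ~ x `<=` p;
  side_not_prime : forall x, (A `|` B) x -> ~ prime_filter p;
  side_join : forall x y, A x -> B y -> x `&` y `<=` p;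
  side_cover : forall u w, p (u `|` w) -> ~ p u -> ~ p w ->
    exists x y, [/\ A x, B y & (x u /\ y w) \/ (x w /\ y u)] }.

(** Fix an edge a0 ~ a1. The two classes of the bipartite graph are the
    neighbours of a1 and those of a0, and a prime filter goes to a class when it
    has elements outside p and all of these are in the class. *)
Lemma exists_cofactor_sides p :
  identity_L2 L -> identity_U L -> identity_B L -> filter_irreducible p ->
  exists AB : set (set L) * set (set L), cofactor_sides p AB.1 AB.2.
Proof.
move=> idL idU idB irrp; have filp := irreducible_filter irrp.
have up := filter_up filp.
have [pprime|pnprime] := pselect (prime_filter p).
  exists (set0, set0); split=> [x|x|x|x|x y|u w /=]; try by case.
  by move=> puw nu nw; case: pprime => _ /(_ _ _ puw) [].
have [a0 [a1 [pa na0 na1]]] : exists a0 a1, [/\ p (a0 `|` a1), ~ p a0 & ~ p a1].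
  apply: contrapT => noedge; apply: pnprime; split=> // a b pab.
  by apply: contrapT => /not_orP[na nb]; apply: noedge; exists a, b.
pose side a : set (set L) := [set x | [/\ prime_filter x, ~ x `<=` p &
  forall s, x s -> p (s `|` a)]].
have side_nota a x : ~ p a -> side a x -> ~ x a.
  by move=> na [_ _ xa] /xa; rewrite joinxx.
have triangle a b c : p (a `|` b) -> p (b `|` c) -> p (a `|` c) ->
    ~ p a -> ~ p b -> p c.
  by move=> pab pbc pac na nb; case: (irreducible_U idU irrp pab pbc pac).
exists (side a1, side a0); split=> /=.
- by move=> x [] [].
- by move=> x [] /side_nota nx; [exists a1|exists a0]; apply: nx.
- by move=> x [] [].
- by [].
- move=> x y [_ _ xa1] [_ _ ya0] s [/xa1 sa1 /ya0 sa0].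
  by apply: (triangle a0 a1) => //; rewrite joinC.
move=> u w puw nu nw.
(* In the square through the edges a ~ a' and s ~ t, where t ~ a', the vertex t
   cannot be adjacent to a as well. *)
have shift a a' s t : p (a `|` a') -> ~ p a -> ~ p a' -> p (s `|` t) ->
    ~ p t -> p (t `|` a') -> p (s `|` a).
  move=> paa' na na' pst nt pta'.
  have [ps|ns] := pselect (p s); first by apply: (up _ _ ps); rewrite leUl.
  case: (irreducible_B idB irrp na na' ns nt paa' pst) => -[pas pa's].
    by rewrite joinC.
  by case: nt; apply: (triangle a a'); rewrite // joinC.
have side_ex a a' s t : p (a `|` a') -> ~ p a -> ~ p a' -> p (s `|` t) ->
    ~ p s -> ~ p t -> p (t `|` a') -> exists2 x, side a x & x s.
  move=> paa' na na' pst ns nt pta'.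
  have [x [prx xs xt]] := exists_prime_cofactor idL irrp ns pst.
  exists x => //; split=> // [xp|r /xt prt]; first by apply/ns/xp.
  exact: shift pta'.
have pa' : p (a1 `|` a0) by rewrite joinC.
have puw' : p (w `|` u) by rewrite joinC.
case: (irreducible_B idB irrp na0 na1 nu nw pa puw) => -[pa0 pa1].
  have [|x sx xw] := side_ex a1 a0 w u pa' na1 na0 puw' nw nu.
    by rewrite joinC.
  have [|y sy yu] := side_ex a0 a1 u w pa na0 na1 puw nu nw.
    by rewrite joinC.
  by exists x, y; split=> //; right.
have [|x sx xu] := side_ex a1 a0 u w pa' na1 na0 puw nu nw.
  by rewrite joinC.
have [|y sy yw] := side_ex a0 a1 w u pa na0 na1 puw' nw nu.
  by rewrite joinC.
by exists x, y; split=> //; left.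
Qed.

End Filters.

(** * Forests of stars *)

(** A point is a triple of a component, a level and a label; points are compared
    only inside a component, by their levels. *)
Definition layered (I T : choiceType) (V : I -> nat -> T -> Prop) : Type :=
  {z : I * nat * T | `[< V z.1.1 z.1.2 z.2 >]}.

Section LayeredPoset.
Context {I T : choiceType} {V : I -> nat -> T -> Prop}.
Implicit Types z w t : layered V.

HB.instance Definition _ := Choice.on (layered V).

Definition component z : I := (val z).1.1.

Definition level z : nat := (val z).1.2.

Definition label z : T := (val z).2.

Definition layered_le z w : bool :=
  (z == w) || ((component z == component w) && (level z < level w)%N).

Lemma layered_le_refl : reflexive layered_le.
Proof. by move=> z; rewrite /layered_le eqxx. Qed.

Lemma layered_le_anti : antisymmetric layered_le.
Proof.
move=> z w /andP[/orP[/eqP//|/andP[_ zw]]] /orP[/eqP//|/andP[_ wz]].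
by have := ltn_trans zw wz; rewrite ltnn.
Qed.

Lemma layered_le_trans : transitive layered_le.
Proof.
move=> w z t /orP[/eqP->//|/andP[/eqP czw zw]] /orP[/eqP<-|/andP[/eqP cwt wt]].
  by rewrite /layered_le czw zw eqxx orbT.
by rewrite /layered_le czw cwt (ltn_trans zw wt) eqxx orbT.
Qed.

Fact layered_display : Order.disp_t. Proof. exact: (Order.Disp tt tt). Qed.

HB.instance Definition _ := Order.Le_isPOrder.Build layered_display (layered V)
  layered_le_refl layered_le_anti layered_le_trans.

Lemma vertexP z : V (component z) (level z) (label z).
Proof. by case: z => z /= Vz; apply/asboolP. Qed.

Definition vertex p i x (Vz : V p i x) : layered V :=
  exist _ (p, i, x) (asboolT Vz).

Lemma layered_eq z w : component z = component w -> level z = level w ->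
  label z = label w -> z = w.
Proof.
rewrite /component /level /label => c l b; apply: val_inj.
by case: (val z) (val w) c l b => [[? ?] ?] [[? ?] ?] /= -> -> ->.
Qed.

Lemma layered_ltE z w :
  (z < w) = (component z == component w) && (level z < level w)%N.
Proof.
rewrite lt_neqAle /Order.le /= /layered_le; case: eqP => [->|_] //=.
by rewrite ltnn andbF.
Qed.

Lemma chain_level_inj (C : set (layered V)) z w :
  is_chain C -> C z -> C w -> level z = level w -> z = w.
Proof.
move=> chC Cz Cw zw; have [//|nzw] := eqVneq z w.
have [] := chC z w Cz Cw; rewrite le_eqVlt.
  by rewrite (negPf nzw) layered_ltE zw ltnn andbF.
by rewrite eq_sym (negPf nzw) layered_ltE zw ltnn andbF.
Qed.

End LayeredPoset.

(** Each component is a star: one center at level 1, leaves at levels 0 and 2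
    below and above it. *)
Record star_shaped (I T : choiceType) (V : I -> nat -> T -> Prop) : Prop := {
  star_level : forall p i x, V p i x -> (i <= 2)%N;
  star_center : forall p i x, V p i x -> exists y, V p 1%N y;
  star_center_uniq : forall p x y, V p 1%N x -> V p 1%N y -> x = y }.

Section StarForest.
Context {I T : choiceType} {V : I -> nat -> T -> Prop}.
Hypothesis starV : star_shaped V.
Implicit Types z w t : layered V.

Lemma level_le2 z : (level z <= 2)%N.
Proof. by have := star_level starV (vertexP z). Qed.

Lemma star_length : length_at_most 2 (layered V).
Proof.
move=> C chC.
have lvl_uniq : uniq (map level C).
  rewrite map_inj_in_uniq ?fset_uniq // => z w zC wC.
  exact: (chain_level_inj chC).
have lvl_sub : {subset map level C <= iota 0 3}.
  move=> i /mapP[z _ ->]; rewrite mem_iota /= add0n ltnS.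
  exact: level_le2.
have := uniq_leq_size lvl_uniq lvl_sub.
by rewrite size_map size_iota leq_subLR.
Qed.

Lemma star_finite_chain (C : set (layered V)) : is_chain C -> finite_set C.
Proof.
move=> chC; have : finite_set [set level z | z in C].
  apply: (@sub_finite_set _ _ `I_3) (finite_II 3) => _ [z Cz <-] /=.
  exact: level_le2.
rewrite (eq_finite_set (inj_card_eq _)) // => z w /set_mem Cz /set_mem Cw.
exact: (chain_level_inj chC).
Qed.

Lemma center_uniq z w : component z = component w ->
  level z = 1%N -> level w = 1%N -> z = w.
Proof.
move=> czw lz lw; apply: layered_eq; rewrite ?lz ?lw //.
have := vertexP z; have := vertexP w; rewrite lz lw -czw => Vw Vz.
exact: (star_center_uniq starV Vz Vw).
Qed.

(** A leaf at level 0 is not covered by a leaf at level 2, as the center lies in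
    between. *)
Lemma adjacent_center z w : hasse_adjacent z w ->
  component z = component w /\ (level z == 1%N) != (level w == 1%N).
Proof.
suff cov t t' : covered t t' -> component t = component t' /\
    (level t == 1%N) != (level t' == 1%N).
  by move=> /asboolP[/cov//|/cov[-> ne]]; split=> //; rewrite eq_sym.
case; rewrite layered_ltE => /andP[/eqP ctt' lt] ncov; split=> //.
have := level_le2 t'.
have [y Vy] := star_center starV (vertexP t).
have := ncov (vertex Vy); rewrite !layered_ltE -ctt' /=.
have -> : component (vertex Vy) = component t by [].
have -> : level (vertex Vy) = 1%N by [].
rewrite eqxx /= => /(introN andP).
by case: (level t) (level t') lt => [|[|i]] [|[|[|j]]].
Qed.

(** Centers and leaves alternate along a path, so a path without repetition goes
    through the only center of its component at most once. *)
Lemma hasse_path_short z w s : hasse_path z w s ->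
  [\/ s = [::] /\ z = w,
      s = [:: w] /\ hasse_adjacent z w |
      exists2 t, s = [:: t; w] &
        [/\ hasse_adjacent z t, hasse_adjacent t w & level t = 1%N] ].
Proof.
case: s => [|t [|w' [|w'' s]]] [/= adj].
- by move=> ->; constructor 1.
- by move=> <- _; constructor 2; case/andP: adj.
- move=> <-; rewrite !inE !negb_or => /and3P[/andP[_ zw'] _ _].
  move: adj => /and3P[zt tw' _]; constructor 3; exists t => //; split=> //.
  have [czt lzt] := adjacent_center zt; have [ctw ltw] := adjacent_center tw'.
  apply/eqP; apply: contraNT zw' => t1; apply/eqP/center_uniq.
  + by rewrite czt.
  + by apply/eqP; move: lzt; rewrite (negPf t1); case: (level z == _).
  + by apply/eqP; move: ltw; rewrite (negPf t1); case: (level w' == _).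
- move=> _; rewrite !inE !negb_or.
  move=> /and4P[/and4P[_ zw' _ _] /and3P[_ tw'' _] _ _].
  move: adj => /and4P[zt tw' w'w'' _].
  have [czt lzt] := adjacent_center zt; have [ctw ltw] := adjacent_center tw'.
  have [cww lww] := adjacent_center w'w''.
  have [t1|t1] := eqVneq (level t) 1%N.
    case/negP: tw''; apply/eqP/center_uniq; rewrite ?ctw // .
    by apply/eqP; move: ltw lww; rewrite t1;
      case: (level w' == _); case: (level w'' == _).
  case/negP: zw'; apply/eqP/center_uniq; rewrite ?czt //; apply/eqP.
    by move: lzt; rewrite (negPf t1); case: (level z == _).
  by move: ltw; rewrite (negPf t1); case: (level w' == _).
Qed.

Lemma star_tree_like : tree_like (layered V).
Proof.
split=> [C chC _ _|z w s s' zs zs']; first exact: star_finite_chain.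
have loop (r : seq (layered V)) : hasse_path z w r -> z = w -> r = [::].
  case: r => // t r [_ /= zw /andP[zNr _]] zEw.
  by case/negP: zNr; rewrite zEw -zw mem_last.
have [zw|nzw] := eqVneq z w; first by rewrite (loop s) // (loop s').
have nadj (t : layered V) : hasse_adjacent z w ->
    ~ [/\ hasse_adjacent z t, hasse_adjacent t w & level t = 1%N].
  move=> /adjacent_center[_ zw] [/adjacent_center[_ zt]].
  move=> /adjacent_center[_ tw] t1; move: zw zt tw; rewrite t1.
  by case: (level z == _); case: (level w == _).
have [[_ /eqP]|[-> zw]|[t -> zt]] := hasse_path_short zs;
  have [[_ /eqP]|[-> zw']|[t' -> zt']] := hasse_path_short zs';
  rewrite ?(negPf nzw) //.
- by case: (nadj t' zw).
- by case: (nadj t zw').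
- case: zt zt' => /adjacent_center[zt _] _ t1 [/adjacent_center[zt' _] _ t'1].
  by rewrite (@center_uniq t t') // -zt.
Qed.

End StarForest.

(** * The embedding into convex sets of a forest of filters *)

Section FilterForest.
Context {d : Order.disp_t} {L : latticeType d}.
Variables A B : set L -> set (set L).
Hypothesis sidesAB :
  forall p, filter_irreducible p -> cofactor_sides p (A p) (B p).
Implicit Types (u w : L) (p q x y : set L).

(** Once the stars whose center is a leaf elsewhere are discarded, the filter of
    a center occurs nowhere else in the forest; [agree_off_root_nonzero] depends
    on this. *)
Definition root p : Prop :=
  filter_irreducible p /\ forall q, filter_irreducible q -> ~ (A q `|` B q) p.

Definition star_vertex p (i : nat) x : Prop :=
  root p /\ match i with
            | 0 => A p x
            | 1 => x = p
            | 2 => B p x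
            | _ => False
            end.

Local Notation forest := (layered star_vertex).
Implicit Types z : forest.

Lemma star_vertex_shaped : star_shaped star_vertex.
Proof.
split=> [p [|[|[|i]]] x|p i x|p x y] /=; rewrite /star_vertex; try by case.
  by move=> [rp _]; exists p.
by move=> [_ ->] [_ ->].
Qed.

Lemma root_component z : root (component z).
Proof. by case: (vertexP z). Qed.

Lemma component_sides z :
  cofactor_sides (component z) (A (component z)) (B (component z)).
Proof. by apply: sidesAB; case: (root_component z). Qed.

Lemma label_cases z :
  (level z = 1%N /\ label z = component z) \/
  (level z <> 1%N /\ (A (component z) `|` B (component z)) (label z)).
Proof.
have [_] := vertexP z.
case: (level z) => [|[|[|i]]] //= lab; [right|left|right]; split=> //.
  by left.
by right.
Qed.

Lemma label_filter z : lattice_filter (label z).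
Proof.
have [[_ ->]|[_ /(side_prime (component_sides z))[]//]] := label_cases z.
by apply: irreducible_filter; case: (root_component z).
Qed.

Lemma label_proper z : exists a, ~ label z a.
Proof.
have [[_ ->]|[_ /(side_proper (component_sides z))//]] := label_cases z.
have [[v [_ sub _]] _] := root_component z.
by exists v => /sub; apply.
Qed.

Definition embed_set u : set forest := [set z | label z u].

Lemma embed_convex u : order_convex (embed_set u).
Proof.
move=> z1 z2 z; rewrite /embed_set /= => u1 u2.
rewrite !le_eqVlt => /orP[/eqP<-//|z1z] /orP[/eqP->//|zz2].
move: z1z zz2; rewrite !layered_ltE => /andP[/eqP c1 l1] /andP[/eqP c2 l2].
have := vertexP z; have := vertexP z1; have := vertexP z2.
have := level_le2 star_vertex_shaped z2.
rewrite c1 -c2.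
case: (level z1) (level z) (level z2) l1 l2 =>
  [|i] [|[|j]] [|[|[|k]]] //= _ _ _.
move=> [_ Bz2] [_ Az1] [_ ->].
exact: (side_join (component_sides z)) Az1 Bz2 _ (conj u1 u2).
Qed.

Definition embed u : Co forest := MkCo (asboolT (@embed_convex u)).

Lemma embedE u z : co_set (embed u) z = label z u.
Proof. by []. Qed.

Lemma embed_meet : Order.meet_morphism embed.
Proof.
move=> u w; apply: val_inj; apply/seteqP; split=> z /=; rewrite /embed_set /=.
  move=> zuw; have up := filter_up (label_filter z).
  by split; apply: (up _ _ zuw); rewrite ?leIl ?leIr.
by case; apply: filter_meet (label_filter z) _ _.
Qed.

Lemma embed_homo : {homo embed : u w / u <= w}.
Proof.
by move=> u w /meet_idPl uw; apply/meet_idPl; rewrite -embed_meet uw.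
Qed.

(** At a leaf the filter is prime. At the center, a nontrivial join into p comes
    from one leaf on each side, and the center lies between them. *)
Lemma embed_join : Order.join_morphism embed.
Proof.
move=> u w; apply/le_anti/andP; split; last first.
  by rewrite leUx !embed_homo ?leUl ?leUr.
apply/le_coP => z; rewrite embedE => zuw.
have [zu|nzu] := pselect (label z u); first exact: co_joinl.
have [zw|nzw] := pselect (label z w); first exact: co_joinr.
have sides := component_sides z.
have [[lz zp]|[_ /(side_prime sides)[_ /(_ _ _ zuw)[]//]]] := label_cases z.
rewrite zp in zuw nzu nzw.
have [x [y [Ax By xy]]] := side_cover sides zuw nzu nzw.
have Vx : star_vertex (component z) 0 x by split=> //; apply: root_component.
have Vy : star_vertex (component z) 2 y by split=> //; apply: root_component.
exists (vertex Vx), (vertex Vy); split.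
- by case: xy => -[? ?]; [left|right].
- by case: xy => -[? ?]; [right|left].
by apply/andP; split; apply: ltW; rewrite layered_ltE lz eqxx.
Qed.

(** If p is a leaf of the star of q, then q is not prime, so q is a leaf of no
    star, hence a root. *)
Lemma exists_vertex p : filter_irreducible p ->
  exists z, label z = p.
Proof.
move=> irrp.
have [rp|] := pselect (root p).
  have Vp : star_vertex p 1 p by [].
  by exists (vertex Vp).
move=> /not_andP[//|/existsNP[q /not_implyP[irrq /contrapT qp]]].
have rq : root q.
  split=> // r irrr rq; apply: (side_not_prime (sidesAB irrq) qp).
  exact: side_prime (sidesAB irrr) _ rq.
case: qp => qp.
  have Vp : star_vertex q 0 p by [].
  by exists (vertex Vp).
have Vp : star_vertex q 2 p by [].
by exists (vertex Vp).
Qed.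

Lemma embed_le u w : embed u <= embed w -> u <= w.
Proof.
move=> /le_coP uw.
apply: contrapT => /exists_irreducible_filter[p [irrp pu npw]].
have [z zp] := exists_vertex irrp.
by apply: npw; rewrite -zp; apply: uw; rewrite embedE zp.
Qed.

Lemma embed_inj : injective embed.
Proof. by move=> u w uw; apply/le_anti; rewrite !embed_le // uw lexx. Qed.

Lemma embed_lattice_embedding : lattice_embedding embed.
Proof. by split; [exact: embed_inj|exact: embed_meet|exact: embed_join]. Qed.

Lemma least_not_label u z : least u -> ~ label z u.
Proof.
move=> u0 zu; have [a] := label_proper z; apply.
by apply: (filter_up (label_filter z)) zu _; apply: u0.
Qed.

Lemma embed_bounds : preserves_existing_bounds embed.
Proof.
split=> u ub M _; apply/le_coP => z; rewrite embedE.
  by move/(least_not_label ub).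
move=> _; have [a za] := filter_nonempty (label_filter z).
by apply: (filter_up (label_filter z)) za _; apply: ub.
Qed.

Lemma forest_finite : finite_set [set: L] -> finite_set [set: forest].
Proof.
move=> finL.
have finS : finite_set [set: set L].
  have [s sE] := (finite_seqP [set: L]).1 finL.
  apply: (@sub_finite_set _ _
    [set [set` mask m s] | m in [set: (size s).-tuple bool]]).
    move=> x _ /=; exists (map_tuple (fun a => `[< x a >]) (in_tuple s)) => //.
    apply/seteqP; split=> a /=; rewrite -filter_mask mem_filter.
      by case/andP => /asboolP.
    move=> xa; apply/andP; split; first exact/asboolP.
    by have : [set` s] a by rewrite -sE.
  exact: finite_image.
have fin3 := finite_setX (finite_setX finS (finite_II 3)) finS.
have : finite_set
    (val @^-1` ([set: set L] `*` `I_3 `*` [set: set L]) : set forest).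
  by apply: finite_preimage fin3 => z w _ _; apply: val_inj.
apply: sub_finite_set => z _; split=> //; split=> //=.
exact: (level_le2 star_vertex_shaped).
Qed.

Lemma filter_generator x : finite_set [set: L] -> lattice_filter x ->
  exists2 g, x g & forall a, x a -> g <= a.
Proof.
move=> /finite_seqP[s sE] [[e xe] _ xI].
suff [g xg gs] : exists2 g, x g & forall a, a \in s -> x a -> g <= a.
  by exists g => // a; apply: gs; have : [set: L] a by []; rewrite sE.
elim: s {sE} => [|a s [g xg gs]]; first by exists e.
have [xa|nxa] := pselect (x a).
  exists (a `&` g); first exact: xI.
  move=> b; rewrite inE => /predU1P[->|bs xb]; first by rewrite leIl.
  by rewrite leIxr ?gs.
by exists g => // b; rewrite inE => /predU1P[->|/gs].
Qed.

(** The second disjunct excludes the center of p, the only vertex at level 1 of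
    its component. *)
Definition agree_off_root p u w : Prop :=
  forall z, component z <> p \/ level z <> 1%N -> label z u <-> label z w.

Lemma label_up z u w : u <= w -> label z u -> label z w.
Proof. by move=> uw zu; apply: (filter_up (label_filter z)) zu uw. Qed.

Lemma label_meet z u w : label z (u `&` w) <-> label z u /\ label z w.
Proof.
split=> [zuw|[zu zw]]; last exact: filter_meet (label_filter z) _ _ zu zw.
by split; apply: label_up zuw; rewrite ?leIl ?leIr.
Qed.

(** Removing the center p does not affect joins, because it is never an extreme
    point of an interval that contains another vertex in its interior. *)
Lemma agree_off_root_join p u w u' w' z :
  agree_off_root p u w -> agree_off_root p u' w' ->
  component z <> p \/ level z <> 1%N ->
  label z (u `|` u') -> label z (w `|` w').
Proof.
move=> uw uw' zp zuu'.
have up (t : forest) : component t <> p \/ level t <> 1%N ->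
    label t u \/ label t u' -> co_set (embed w `|` embed w') t.
  move=> tp [/uw|/uw'] tw; [apply: co_joinl|apply: co_joinr]; exact: tw.
rewrite -embedE embed_join.
have [[lz zc]|[lz /(side_prime (component_sides z))[_]]] := label_cases z.
  have zNp : component z <> p by case: zp.
  have : co_set (embed (u `|` u')) z by [].
  rewrite embed_join => -[z1 [z2 [z1u z2u /andP[z1z zz2]]]].
  have same (t t' : forest) : t <= t' -> component t = component t'.
    by rewrite le_eqVlt layered_ltE => /orP[/eqP->|/andP[/eqP]].
  have c1 := same _ _ z1z; have c2 := same _ _ zz2.
  apply: (coP _ _ z1z zz2); apply: up => //.
    by left; rewrite c1.
  by left; rewrite -c2.
by move=> /(_ _ _ zuu'); apply: up; right.
Qed.

Lemma agree_off_root_congruence p : congruence (agree_off_root p).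
Proof.
have sym u w : agree_off_root p u w -> agree_off_root p w u.
  by move=> uw z /uw ->.
split=> //.
- by move=> u w t uw wt z zp; rewrite uw ?wt.
- by move=> u w u' w' uw uw' z zp; rewrite !label_meet uw ?uw'.
- move=> u w u' w' uw uw' z zp.
  by split; apply: agree_off_root_join; try exact: zp; try exact: sym.
Qed.

(** The generator g of p and its meet with v, the element that p misses, are
    identified: a vertex other than p whose filter contains g is a filter
    strictly containing p, so it contains v. *)
Lemma agree_off_root_nonzero p :
  finite_set [set: L] -> root p -> nonzero (agree_off_root p).
Proof.
move=> finL [irrp nsides].
have [g pg gp] := filter_generator finL (irreducible_filter irrp).
have [v [_ pv pmax]] := irrp.
exists g, (g `&` v); split; last first.
  by move=> gv; apply: (pv _ pg); rewrite gv leIr.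
move=> z zp; rewrite label_meet; split=> [zg|[]//]; split=> //.
have px : p `<=` label z by move=> a /gp ga; apply: label_up zg.
have [c zc npc] : exists2 c, label z c & ~ p c.
  apply: contrapT => nc; have xp : label z = p.
    apply/seteqP; split=> // a za; apply: contrapT => npa.
    by apply: nc; exists a.
  have [[lz zE]|[lz]] := label_cases z; last first.
    by rewrite xp; apply: nsides; case: (root_component z).
  by case: zp => //; case; rewrite -zE xp.
have [s ps /contrapT scv] := pmax c npc.
by apply: label_up scv _; apply/label_meet; split=> //; apply: px.
Qed.

(** By [side_join], a leaf occurring on both sides of the star of p would be
    included in p, and so would p itself as a leaf; this is excluded by
    [side_not_below]. *)
Lemma vertex_label_inj z z' :
  component z = component z' -> label z = label z' -> z = z'.
Proof.
move=> cE lE; apply: layered_eq => //.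
have sides := component_sides z.
have nA : ~ A (component z) (component z).
  by move=> Ac; case: (side_not_below sides (or_introl Ac)).
have nB : ~ B (component z) (component z).
  by move=> Bc; case: (side_not_below sides (or_intror Bc)).
have nAB x : A (component z) x -> ~ B (component z) x.
  move=> Ax Bx; case: (side_not_below sides (or_introl Ax)) => a xa.
  by apply: (side_join sides Ax Bx); split.
have := vertexP z; have := vertexP z'; rewrite -cE -lE => -[_ + [_]].
case: (level z) (level z') => [|[|[|i]]] [|[|[|j]]] //.
- by move=> ->.
- by move=> ? /nAB.
- by move=> + xE; rewrite xE.
- by move=> + xE; rewrite xE.
- by move=> /nAB.
- by move=> ->.
Qed.

(** A vertex cannot be the center of two stars, so elements that agree off p and
    off q agree everywhere; but the monolith is included in both congruences. *)
Lemma subdirectly_irreducible_one_root p q :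
  finite_set [set: L] -> subdirectly_irreducible L ->
  root p -> root q -> p = q.
Proof.
move=> finL [m [mC [u [w [muw nuw]]] mmin]] rp rq; apply: contrapT => npq.
apply: nuw; apply: embed_inj; apply: val_inj; apply/seteqP.
have all r : root r -> agree_off_root r u w.
  by move=> rr; apply: mmin muw; [exact: agree_off_root_congruence|
    exact: agree_off_root_nonzero].
suff agree z : label z u <-> label z w by split=> z /= /agree.
have [cp|ncp] := pselect (component z = p).
  by apply: (all q) => //; left; rewrite cp.
by apply: (all p) => //; left.
Qed.

(** A proper filter containing the atom a consists of the elements above a, so
    the image of a has one vertex at most. *)
Lemma embed_atom_preserving : finite_set [set: L] ->
  subdirectly_irreducible L -> atom_preserving embed.
Proof.
move=> finL si a [o leasto [oa noa]].
have label_atom z w : label z a -> label z w -> a <= w.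
  move=> za zw; have zaw : label z (a `&` w) by apply/label_meet.
  have [oaw|noaw] := eqVneq o (a `&` w).
    by case: (least_not_label leasto (z := z)); rewrite oaw.
  apply/meet_idPl/eqP; apply: contrapT => /negP naw.
  apply: (noa (a `&` w)); rewrite !lt_neqAle noaw naw leIl; split=> //.
  by rewrite leasto.
have one z1 z2 : label z1 a -> label z2 a -> z1 = z2.
  move=> z1a z2a.
  have c12 : component z1 = component z2.
    by apply: subdirectly_irreducible_one_root => //; apply: root_component.
  have l12 : label z1 = label z2.
    by apply/seteqP; split=> w /label_atom aw; apply: label_up (aw _) _.
  exact: vertex_label_inj.
exists (embed o); first by case: embed_bounds => + _; apply.
split.
  rewrite lt_neqAle embed_homo ?leasto // andbT; apply/eqP => /embed_inj oE.
  by rewrite oE ltxx in oa.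
move=> Y [oY Ya]; move: (ltW Ya) => /le_coP subYa.
have [t Yt] : exists t, co_set Y t.
  apply: contrapT => nY; have /negP[] : ~~ (Y <= embed o) by rewrite lt_geF.
  by apply/le_coP => t Yt; case: nY; exists t.
have /negP[] : ~~ (embed a <= Y) by rewrite lt_geF.
apply/le_coP => z za.
by rewrite (one z t) //; apply: subYa.
Qed.

End FilterForest.

(** * The equivalence *)

Lemma exists_tree_embedding (d : Order.disp_t) (L : latticeType d) :
  identity_L2 L -> identity_U L -> identity_B L ->
  exists (d' : Order.disp_t) (Gamma : porderType d') (phi : L -> Co Gamma),
     [/\ tree_like Gamma,
         length_at_most 2 Gamma,
         lattice_embedding phi,
         preserves_existing_bounds phi &
         (finite_set [set: L] -> finite_set [set: Gamma]) /\
         (finite_set [set: L] -> subdirectly_irreducible L ->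
            atom_preserving phi)].
Proof.
move=> idL idU idB.
have /choice[AB sidesAB] p : exists AB : set (set L) * set (set L),
    filter_irreducible p -> cofactor_sides p AB.1 AB.2.
  have [irrp|nirrp] := pselect (filter_irreducible p).
    have [AB sides] := exists_cofactor_sides idL idU idB irrp.
    by exists AB.
  by exists (set0, set0).
pose A p := (AB p).1; pose B p := (AB p).2.
have sides p : filter_irreducible p -> cofactor_sides p (A p) (B p).
  exact: sidesAB.
exists layered_display, (layered (star_vertex A B)), (embed sides).
split.
- exact: star_tree_like (star_vertex_shaped A B).
- exact: star_length (star_vertex_shaped A B).
- exact: embed_lattice_embedding.
- exact: embed_bounds.
- by split; [exact: forest_finite|exact: embed_atom_preserving].
Qed.

Theorem theorem3p7 (d : Order.disp_t) (L : latticeType d) :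
  (SUB 2 L <-> [/\ identity_L2 L, identity_U L & identity_B L]) /\
  (SUB 2 L <->
   exists (d' : Order.disp_t) (Gamma : porderType d') (phi : L -> Co Gamma),
     [/\ tree_like Gamma,
         length_at_most 2 Gamma,
         lattice_embedding phi,
         preserves_existing_bounds phi &
         (finite_set [set: L] -> finite_set [set: Gamma]) /\
         (finite_set [set: L] -> subdirectly_irreducible L ->
            atom_preserving phi)]).
Proof.
have SUB_id : SUB 2 L -> [/\ identity_L2 L, identity_U L & identity_B L].
  move=> [d' [P [f [len embf]]]]; split.
  - exact: embedding_identity_L2 embf (Co_identity_L2 len).
  - exact: embedding_identity_U embf Co_identity_U.
  - exact: embedding_identity_B embf Co_identity_B.
have tree_SUB d' (Gamma : porderType d') (phi : L -> Co Gamma) :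
    length_at_most 2 Gamma -> lattice_embedding phi -> SUB 2 L.
  by move=> len embphi; exists d', Gamma, phi.
split; split=> //.
- move=> [idL idU idB].
  have [d' [Gamma [phi [_ len embphi _ _]]]] :=
    exists_tree_embedding idL idU idB.
  exact: tree_SUB len embphi.
- by move=> /SUB_id[]; apply: exists_tree_embedding.
- by move=> [d' [Gamma [phi [_ len embphi _ _]]]]; apply: tree_SUB len embphi.
Qed.
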